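(* Let $G$ be a finite simple undirected graph with $n$ vertices, $m$ edges, $k$ connected components, and let $c_1$ denote the number of induced cycles of $G$ whose length is congruent to $1$ modulo $3$. Then $$\mathrm{diss}(G)\;\geq\; n-\frac{1}{3}\big(m+k+c_1\big).$$
   Context: A set $D$ of vertices of a graph $G$ is a dissociation set if the subgraph $G[D]$ induced by $D$ has maximum degree at most $1$. The dissociation number $\mathrm{diss}(G)$ is the maximum cardinality of a dissociation set of $G$. An induced cycle of $G$ is a cycle subgraph $C$ of $G$ (of length at least $3$) such that $G[V(C)]=C$; $c_1$ counts such subgraphs of length $\ell\equiv 1 \pmod 3$. *)

(* Defs.v *)
From mathcomp Require Import all_boot all_order all_algebra.
Set Implicit Arguments. Unset Strict Implicit. Unset Printing Implicit Defensive.

(* A finite simple undirected graph: vertex type T : finType, adjacency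
   relation e : rel T, assumed symmetric and irreflexive in the theorem. *)

Section Graph.
Variables (T : finType) (e : rel T).

Definition dissociation_set (D : {set T}) : bool :=
  [forall x in D, #|[set y in D | e x y]| <= 1].

Definition diss : nat :=
  \max_(D : {set T} | dissociation_set D) #|D|.

Definition nedges : nat :=
  #|[set E : {set T} | [exists x, [exists y, e x y && (E == [set x; y])]]]|.

Definition ncomps : nat := n_comp e T.

Definition induced_rel (S : {set T}) : rel T :=
  [rel x y | [&& x \in S, y \in S & e x y]].

(* S is the vertex set of an induced cycle: G[S] is a cycle, i.e.
   |S| >= 3, G[S] is 2-regular and connected. *)
Definition induced_cycle (S : {set T}) : bool :=
  [&& 3 <= #|S|,
      [forall x in S, #|[set y in S | e x y]| == 2] &
      [forall x in S, [forall y in S, connect (induced_rel S) x y]]].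

Definition c1 : nat :=
  #|[set S : {set T} | induced_cycle S && (#|S| %% 3 == 1)]|.

End Graph.

(* Main.v *)
(** Equivalently, some set R of at most (m + k + c_1)/3 vertices has a
    dissociation set as its complement. Such an R is built by repeatedly deleting
    a set X of vertices, of which only those in R are charged: it suffices that
    the deletion lowers m + k + c_1 by at least 3 |R|. Three configurations have
    this property, besides components with at most two vertices: a pendant path
    u - v - w with v of degree 2 (charge w); a cycle all of whose vertices but one
    have degree 2 (charge every third vertex; a length congruent to 1 modulo 3
    costs one extra vertex, paid for by c_1 because such a cycle is induced); and
    a vertex v of degree at least 3 all of whose neighbours outside one component
    of G - v are leaves (charge v). One of them always occurs: among the vertices v
    of degree at least 3 choose one with a largest component K of G - v. The other
    components of G - v at v contain only vertices of degree at most 2, so a walk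
    from v into one of them ends in a leaf or comes back to v. *)
Require Import Defs.
From mathcomp Require Import all_boot all_order all_algebra.
From mathcomp Require Import zify.
Set Implicit Arguments. Unset Strict Implicit. Unset Printing Implicit Defensive.
Import Order.TTheory GRing.Theory Num.Theory.
Local Open Scope ring_scope.

Section Reduction.
Local Open Scope nat_scope.

Variables (T : finType) (e : rel T).
Hypotheses (e_sym : symmetric e) (e_irr : irreflexive e).
Implicit Types (S X Z R Q P L : {set T}) (x y z u v w : T) (p s : seq T).

(** * Induced subgraphs and their connectivity *)

Definition nbrs S x := [set y in S | e x y].

Definition edges_in S := nedges (induced_rel e S).

(** For [C] inside [S], being an induced cycle of [G] or of [G[S]] is the same, so [e] is used
    unrestricted. *)
Definition cycles1_in S :=
  #|[set C : {set T} | [&& C \subset S, induced_cycle e C & #|C| %% 3 == 1]]|.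

Lemma in_nbrs S x y : (y \in nbrs S x) = (y \in S) && e x y.
Proof. by rewrite inE. Qed.

Lemma induced_rel_sym S : symmetric (induced_rel e S).
Proof. by move=> x y; rewrite /induced_rel /= e_sym andbCA. Qed.

Lemma connect_induced_sym S : connect_sym (induced_rel e S).
Proof. exact/sym_connect_sym/induced_rel_sym. Qed.

Lemma connect_edge S x y :
  x \in S -> y \in S -> e x y -> connect (induced_rel e S) x y.
Proof. by move=> xS yS xy; apply: connect1; rewrite /induced_rel /= xS yS. Qed.

(** Induction at the far end of a walk: the start [x] stays fixed and edges are appended at the
    end. *)
Lemma connect_ind_rcons (r : rel T) (A : T -> Prop) x :
  A x -> (forall y z, connect r x y -> A y -> r y z -> A z) ->
  forall y, connect r x y -> A y.
Proof.
move=> Ax step y /connectP[p]; elim/last_ind: p y => [|p z IH] y /=.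
  by move=> _ ->.
rewrite rcons_path last_rcons => /andP[pp lz] ->.
by apply: (step (last x p)) lz; [apply/connectP; exists p | apply: IH].
Qed.

Lemma connect_induced_mem S x y :
  connect (induced_rel e S) x y -> x \in S -> y \in S.
Proof.
move=> xy xS; move: y xy; apply: connect_ind_rcons => // y z _ _.
by case/and3P.
Qed.

Lemma connect_induced_sub S X x y : S \subset X ->
  connect (induced_rel e S) x y -> connect (induced_rel e X) x y.
Proof.
move=> /subsetP sSX; apply: connect_sub => a b /= /and3P[aS bS ab].
by apply: connect_edge => //; apply: sSX.
Qed.

(** A walk from [x] in [G[S]] never leaves the component of [x], so any [Z] containing that
    component contains the walk. *)
Lemma connect_induced_comp S Z x y :
    [set z | connect (induced_rel e S) x z] \subset Z ->
  connect (induced_rel e S) x y -> connect (induced_rel e Z) x y.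
Proof.
move=> /subsetP sZ; move: y; apply: connect_ind_rcons => // y z xy IH yz.
apply: connect_trans IH (connect_edge _ _ _).
- by apply: sZ; rewrite inE.
- by apply: sZ; rewrite inE (connect_trans xy) ?connect1.
- by case/and3P: yz.
Qed.

Lemma dissociationP S :
  reflect (forall x, x \in S -> #|nbrs S x| <= 1) (dissociation_set e S).
Proof. exact: 'forall_in_idP. Qed.

(** * Edges and cycles lost by deleting vertices *)

Lemma edges_inS S X : S \subset X -> edges_in S <= edges_in X.
Proof.
move=> /subsetP sSX; apply/subset_leq_card/subsetP => E.
rewrite !inE => /existsP[x /existsP[y /andP[/and3P[xS yS xy] EE]]].
by apply/existsP; exists x; apply/existsP; exists y; rewrite /induced_rel /= !sSX // xy.
Qed.

Lemma edges_in_rem S x : x \in S ->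
  edges_in (S :\ x) + #|nbrs S x| <= edges_in S.
Proof.
move=> xS; set N := nbrs S x.
have inj : {in N &, injective (fun y => [set x; y])}.
  move=> y z; rewrite !in_nbrs => /andP[_ xy] /andP[_ xz] E.
  have : y \in [set x; z] by rewrite -E set22.
  by rewrite !inE => /orP[/eqP yx|/eqP //]; rewrite yx e_irr in xy.
rewrite -(card_in_imset inj) /edges_in /nedges -cardsUI.
set I := _ :&: _; have -> : I = set0; last rewrite cards0 addn0.
  apply/setP => E; rewrite !inE; apply/negbTE/negP => /andP[].
  move=> /existsP[a /existsP[b /andP[/and3P[aS bS _] /eqP ->]]].
  move=> /imsetP[y _ E']; have: x \in [set a; b] by rewrite E' set21.
  move: aS bS; rewrite !inE => /andP[/negbTE ax _] /andP[/negbTE bx _].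
  by rewrite eq_sym ax eq_sym bx.
apply/subset_leq_card/subsetP => E; rewrite in_setU => /orP[|].
  rewrite !inE => /existsP[a /existsP[b /andP[/and3P[aS bS ab] EE]]].
  apply/existsP; exists a; apply/existsP; exists b; rewrite /induced_rel /= EE ab.
  by move: aS bS; rewrite !inE => /andP[_ ->] /andP[_ ->].
move=> /imsetP[y]; rewrite in_nbrs => /andP[yS xy] ->.
rewrite inE; apply/existsP; exists x; apply/existsP; exists y.
by rewrite /induced_rel /= xS yS xy eqxx.
Qed.

(** The path is deleted vertex by vertex from its head; each vertex takes with it at least the edge
    to its successor. *)
Lemma edges_in_path S x p : uniq (x :: p) -> path e x p ->
    {subset x :: p <= S} ->
  edges_in (S :\: [set z in x :: p]) + size p <= edges_in S.
Proof.
elim: p x S => [|y p IH] x S.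
  by move=> _ _ _; rewrite addn0 edges_inS // subsetDl.
move=> /= /andP[xyp uyp] /andP[xy pyp] sS.
have xS : x \in S by apply: sS; rewrite mem_head.
rewrite addnS; have /(IH y (S :\ x) uyp pyp) : {subset y :: p <= S :\ x}.
  move=> z zyp; rewrite in_setD1 sS 1?in_cons ?zyp ?orbT // andbT.
  by apply: contraNneq xyp => <-.
have -> : S :\ x :\: [set z in y :: p] = S :\: [set z in x :: y :: p].
  by apply/setP => z; rewrite !inE !negb_or; case: (z == x); rewrite ?andbF.
have := edges_in_rem xS.
have : 0 < #|nbrs S x|.
  by apply/card_gt0P; exists y; rewrite in_nbrs xy sS // !inE eqxx orbT.
move: (edges_in _) (edges_in _) (edges_in _) (#|_|) => a b c d; lia.
Qed.

Lemma cycles1_inS S X : S \subset X -> cycles1_in S <= cycles1_in X.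
Proof.
move=> sSX; apply/subset_leq_card/subsetP => C; rewrite !inE.
by case/and3P=> /subset_trans/(_ sSX) -> -> ->.
Qed.

Lemma cycles1_in_rem S X : X \subset S -> induced_cycle e X ->
  #|X| %% 3 = 1 -> cycles1_in (S :\: X) < cycles1_in S.
Proof.
move=> XS cX X1; apply/proper_card/properP; split.
  apply/subsetP => C; rewrite !inE.
  by case/and3P=> /subset_trans/(_ (subsetDl _ _)) -> -> ->.
exists X; rewrite !inE ?XS ?cX ?X1 //= andbT.
have [x xX] : exists x, x \in X.
  by apply/set0Pn; rewrite -card_gt0; case: #|X| X1.
by apply/negP => /subsetP/(_ x xX); rewrite inE xX.
Qed.

(** * Reductions and their effect on components and covers *)

(* Deleting [X] from [S] puts [R] in the cover and [X :\: R] in the dissociation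
   set; the new set [Q] meets every component of [S :\: X] that touches [X], so
   [#|Q| - 1] bounds the growth of the number of components. *)
Record reducible S X R Q : Prop := Reducible {
  red_sub : X \subset S;
  red_conn : exists2 x, x \in X &
    forall y, y \in X -> connect (induced_rel e S) x y;
  red_R : R \subset X;
  red_Q : Q \subset S :\: X;
  red_cut : forall x y, x \in X :\: R -> y \in S :\: X -> ~~ e x y;
  red_diss : dissociation_set e (X :\: R);
  red_dom : forall x y, x \in X -> y \in S :\: X -> e x y ->
    exists2 q, q \in Q & connect (induced_rel e (S :\: X)) y q;
  red_count : 3 * #|R| + #|Q| + edges_in (S :\: X) + cycles1_in (S :\: X)
    <= edges_in S + cycles1_in S + 1 }.

(** Stands in for the number of components: [P] meets every component of [G[S]], so [#|P|] is at
    least that number. *)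
Definition dominating S P :=
  forall x, x \in S -> exists2 q, q \in P & connect (induced_rel e S) x q.

(** All of [X] lies in one component of [G[S]], represented by some [p0] in [P]. Trade [p0] for [Q]:
    a component of [G[S :\: X]] that misses [Q] has no edge to [X], hence is a full component of
    [G[S]] and keeps its representative. *)
Lemma dominating_rem S P X R Q : reducible S X R Q -> P \subset S ->
    dominating S P ->
  exists P', [/\ P' \subset S :\: X, dominating (S :\: X) P' &
    #|P'| + 1 <= #|P| + #|Q|].
Proof.
move=> [XS [x0 x0X cX] _ QS _ _ dom _] PS domP.
have [p0 p0P x0p0] := domP x0 (subsetP XS _ x0X).
exists ((P :\ p0) :\: X :|: Q); split.
- by rewrite subUset QS setSD // (subset_trans (subsetDl _ _)).
- move=> y yS; have [/exists_inP[q qQ yq]|noq] :=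
    boolP [exists q in Q, connect (induced_rel e (S :\: X)) y q].
    by exists q => //; rewrite inE qQ orbT.
  have yall z : connect (induced_rel e S) y z ->
      connect (induced_rel e (S :\: X)) y z.
    move: z; apply: connect_ind_rcons => // z w _ yz /and3P[zS wS zw].
    have zSX := connect_induced_mem yz yS.
    have [wX|wX] := boolP (w \in X); last first.
      by apply: connect_trans yz (connect_edge zSX _ zw); rewrite inE wX.
    have [|q qQ zq] := dom w z wX zSX; first by rewrite e_sym.
    by case/exists_inP: noq; exists q => //; apply: connect_trans yz zq.
  have yS' : y \in S by case/setDP: yS.
  have [q qP yq] := domP y yS'; exists q; last exact: yall.
  have /setDP[_ qX] := connect_induced_mem (yall _ yq) yS.
  rewrite !inE qP qX andbT /= orbC.
  (* If [q] were [p0], then [y] would reach [x0] without leaving [S :\: X], although [x0] is in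
     [X]. *)
  apply/orP; right; apply/eqP => qp0; subst q.
  have /yall/connect_induced_mem/(_ yS) : connect (induced_rel e S) y x0.
    by apply: connect_trans yq _; rewrite connect_induced_sym.
  by rewrite inE x0X.
- have := cardsD1 p0 P; rewrite p0P add1n => ->.
  have := subset_leq_card (subsetDl (P :\ p0) X).
  have := (leq_card_setU ((P :\ p0) :\: X) Q).1; lia.
Qed.

(** By [red_cut] no edge joins [X :\: R] to [S :\: X], so the two dissociation sets can be
    united. *)
Lemma reducible_step S X R Q R' : reducible S X R Q ->
    R' \subset S :\: X -> dissociation_set e ((S :\: X) :\: R') ->
  dissociation_set e (S :\: (R :|: R')).
Proof.
move=> [XS _ RX _ cut /dissociationP dX _ _] R'S /dissociationP dS.
apply/dissociationP => x; rewrite in_setD in_setU negb_or -andbA.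
case/and3P=> xR xR' xS; have [xX|xX] := boolP (x \in X).
  have xXR : x \in X :\: R by rewrite inE xR.
  apply: leq_trans (dX _ xXR); apply/subset_leq_card/subsetP => y.
  rewrite !inE negb_or -!andbA => /and4P[-> _ yS xy] /=; rewrite xy andbT.
  by apply: contraTT xy => yX; apply: (cut _ _ xXR); rewrite inE yX.
have xSX : x \in (S :\: X) :\: R' by rewrite !inE xR' xX.
apply: leq_trans (dS _ xSX); apply/subset_leq_card/subsetP => y.
rewrite !inE negb_or -!andbA => /and4P[yR -> yS xy] /=; rewrite xy yS !andbT.
apply: contraTN xy => yX; rewrite e_sym.
by apply: cut; rewrite inE ?xX ?yX ?yR.
Qed.

(** * Branching vertices, pendant paths and small components *)

(** Delete [v] with its leaves outside the component [K] of [u], charging [v]. The leaves become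
    isolated, and what remains next to [v] lies in [K], so [Q] is [[set u]]. At least three edges at
    [v] pay for the charge. *)
Lemma reducible_leaves S v u : v \in S -> 3 <= #|nbrs S v| ->
    u \in nbrs S v ->
    (forall z, z \in nbrs S v -> connect (induced_rel e (S :\ v)) u z \/
       #|nbrs S z| = 1) ->
  exists X R Q, reducible S X R Q.
Proof.
move=> vS d3; rewrite in_nbrs => /andP[uS vu] leaf.
pose K := [set z | connect (induced_rel e (S :\ v)) u z].
pose X := v |: (nbrs S v :\: K).
have uSv : u \in S :\ v.
  by rewrite !inE uS andbT; apply: contraTneq vu => ->; rewrite e_irr.
have KS z : z \in K -> z \in S :\ v.
  by rewrite inE => /connect_induced_mem/(_ uSv).
have KX z : z \in K -> z \in S :\: X.
  move=> zK; have := KS z zK; rewrite !inE => /andP[/negbTE -> ->].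
  by move: zK; rewrite inE => ->.
have leafP a b : a \in nbrs S v :\: K -> b \in S -> e a b -> b = v.
  case/setDP; rewrite in_nbrs inE => /andP[aS va] aK bS ab.
  have aN : a \in nbrs S v by rewrite in_nbrs aS.
  case: (leaf a aN) => [ac|/eqP/cards1P[c Nc]]; first by rewrite ac in aK.
  have : b \in nbrs S a by rewrite in_nbrs bS.
  have : v \in nbrs S a by rewrite in_nbrs vS e_sym.
  by rewrite Nc !inE => /eqP -> /eqP.
exists X, [set v], [set u]; split.
- apply/subsetP => z; rewrite !inE => /orP[/eqP->//|/and3P[]] //.
- exists v; first by rewrite !inE eqxx.
  move=> y; rewrite !inE => /orP[/eqP->//|/and3P[_ yS vy]].
  exact: connect_edge.
- by rewrite sub1set !inE eqxx.
- by rewrite sub1set; apply: KX; rewrite inE.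
- move=> a b /setDP[]; rewrite in_setU1 in_set1 => /orP[->//|aL] _.
  move=> /setDP[bS bX]; apply/negP => ab; have bv := leafP _ _ aL bS ab.
  by rewrite bv !inE eqxx in bX.
- apply/dissociationP => a /setDP[]; rewrite in_setU1 in_set1.
  case/orP => [->//|aL] _; rewrite (_ : nbrs _ _ = set0) ?cards0 //.
  apply/setP => b; rewrite in_nbrs in_set0; apply/negbTE/negP.
  case/andP=> /setDP[bX bv] ab; case/negP: bv; rewrite inE; apply/eqP.
  apply: leafP aL _ ab; move: bX; rewrite !inE.
  by case/orP => [/eqP->//|/and3P[]].
- move=> a b; rewrite in_setU1 => /orP[/eqP ->|aL] bSX ab; last first.
    by case/setDP: bSX => bS; rewrite (leafP _ _ aL bS ab) !inE eqxx.
  exists u; rewrite ?set11 // connect_induced_sym.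
  apply: (@connect_induced_comp (S :\ v)).
    by apply/subsetP => z zK; apply: KX.
  case/setDP: bSX => bS; rewrite !inE bS ab !andbT negb_or negbK.
  by case/andP.
- have := edges_in_rem vS.
  have /edges_inS : S :\: X \subset S :\ v.
    by apply: setDS; rewrite sub1set !inE eqxx.
  have := @cycles1_inS _ S (subsetDl S X).
  rewrite !cards1; lia.
Qed.

(** Delete all three vertices and charge [w]. With [Q] the other neighbours of [w], the edges lost
    are those at [w], at least [#|Q| + 1], and the edge [u v]. *)
Lemma reducible_pendant S u v w : nbrs S u = [set v] ->
    nbrs S v = [set u; w] -> u != w -> u \in S ->
  exists X R Q, reducible S X R Q.
Proof.
move=> Nu Nv uw uS.
have [vS uv] : v \in S /\ e u v.
  by apply/andP; rewrite -in_nbrs Nu inE.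
have [wS vw] : w \in S /\ e v w.
  by apply/andP; rewrite -in_nbrs Nv !inE eqxx orbT.
have neq a b : e a b -> a != b by apply: contraTneq => ->; rewrite e_irr.
pose X := [set u; v; w].
have XS : X \subset S by apply/subsetP => z; rewrite !inE -orbA => /or3P[]/eqP->.
have nbu b : b \in S -> e u b -> b = v.
  by move=> bS ub; apply/set1P; rewrite -Nu in_nbrs bS.
have nbv b : b \in S -> e v b -> b \in [set u; w].
  by move=> bS vb; rewrite -Nv in_nbrs bS.
exists X, [set w], (nbrs S w :\: X); split => //.
- exists v; first by rewrite !inE eqxx orbT.
  move=> y; rewrite !inE -orbA => /or3P[]/eqP-> //; apply: connect_edge => //.
  by rewrite e_sym.
- by rewrite sub1set !inE eqxx !orbT.
- by apply: setSD; apply/subsetP => z; rewrite in_nbrs => /andP[].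
- move=> a b /setDP[]; rewrite in_set1 !inE => aX aw /andP[bX bS].
  rewrite (negbTE aw) orbF in aX; apply/negP => ab.
  case/orP: aX => /eqP E; rewrite {}E in ab.
    by rewrite (nbu b bS ab) eqxx orbT in bX.
  by have := nbv b bS ab; rewrite !inE => /orP[]/eqP E; rewrite E eqxx ?orbT in bX.
- apply/dissociationP => a; rewrite !inE => /andP[aw].
  rewrite (negbTE aw) orbF => /orP[]/eqP E; rewrite {a}E in aw *.
    apply: (@leq_trans #|[set v]|); last by rewrite cards1.
    apply/subset_leq_card/subsetP => b; rewrite in_nbrs => /andP[/setDP[bX _] ub].
    by rewrite inE (nbu b) // (subsetP XS).
  apply: (@leq_trans #|[set u]|); last by rewrite cards1.
  apply/subset_leq_card/subsetP => b; rewrite in_nbrs => /andP[/setDP[bX bw] vb].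
  by have := nbv b (subsetP XS _ bX) vb; move: bw; rewrite !inE => /negbTE ->; rewrite orbF.
- move=> a b; rewrite !inE => aX /andP[bX bS] ab.
  suff aw : a = w.
    by exists b => //; rewrite !inE bX bS -aw.
  case/orP: aX => [/orP[]/eqP E|/eqP //]; rewrite {}E in ab *.
    by rewrite (nbu b bS ab) eqxx orbT in bX.
  by have := nbv b bS ab; rewrite !inE => /orP[]/eqP E; rewrite E eqxx ?orbT in bX.
- have := edges_in_rem wS.
  have vSw : v \in S :\ w by rewrite !inE vS neq.
  have := edges_in_rem vSw.
  have : 0 < #|nbrs (S :\ w) v|.
    by apply/card_gt0P; exists u; rewrite !inE uw uS e_sym.
  have /edges_inS : S :\: X \subset (S :\ w) :\ v.
    apply/subsetP => z; rewrite !inE !negb_or -!andbA.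
    by case/and4P => _ -> -> ->.
  have := @cycles1_inS _ S (subsetDl S X).
  have : #|nbrs S w :\: X| < #|nbrs S w|.
    apply/proper_card/properP; split; first exact: subsetDl.
    by exists v; rewrite !inE ?vS ?eqxx ?orbT //= e_sym.
  rewrite !cards1; lia.
Qed.

(** Here [x] and its neighbours form a whole component with at most two vertices, so nothing is
    charged and no representative is added. *)
Lemma reducible_small S x : x \in S -> #|nbrs S x| <= 1 ->
    (forall y, y \in nbrs S x -> #|nbrs S y| <= 1) ->
  exists X R Q, reducible S X R Q.
Proof.
move=> xS dx dy; pose X := x |: nbrs S x.
have XS : X \subset S.
  by apply/subsetP => z; rewrite !inE => /orP[/eqP->//|/andP[]].
have dX a : a \in X -> #|nbrs S a| <= 1.
  by rewrite in_setU1 => /orP[/eqP-> //|/dy].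
exists X, set0, set0; split => //.
- exists x; first by rewrite !inE eqxx.
  move=> y; rewrite !inE => /orP[/eqP-> //|/andP[yS xy]].
  exact: connect_edge.
- exact: sub0set.
- exact: sub0set.
- move=> a b; rewrite setD0 => aX /setDP[bS bX]; apply/negP => ab.
  move: (dX a aX); apply/negP; rewrite -ltnNge.
  move: aX bX; rewrite !inE => /orP[/eqP E|/andP[aS xa]].
    by rewrite bS -E ab orbT.
  rewrite bS /= negb_or => /andP[bx xb].
  have <- : #|[set x; b]| = 2 by rewrite cards2 eq_sym bx.
  apply/subset_leq_card/subsetP => z; rewrite !inE => /orP[]/eqP->.
    by rewrite xS e_sym.
  by rewrite bS.
- apply/dissociationP => a; rewrite setD0 => /dX; apply: leq_trans.
  apply/subset_leq_card/subsetP => b; rewrite !in_nbrs => /andP[bX ->].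
  by rewrite (subsetP XS).
- move=> a b aX /setDP[bS bX] ab.
  have := aX; rewrite in_setU1 => /orP[/eqP E|aN].
    by case/negP: bX; rewrite !inE bS -E ab orbT.
  have := dX a aX; move: bX; rewrite in_setU1 negb_or => /andP[bx _].
  move: aN; rewrite in_nbrs => /andP[aS xa].
  have : #|[set x; b]| <= #|nbrs S a|.
    apply/subset_leq_card/subsetP => z; rewrite !inE => /orP[]/eqP->.
      by rewrite xS e_sym.
    by rewrite bS.
  rewrite cards2 eq_sym bx; lia.
- have := edges_inS (subsetDl S X).
  have := @cycles1_inS _ S (subsetDl S X).
  rewrite !cards0; lia.
Qed.

(** * Cycles with at most one vertex of degree above 2 *)

(* The default value [v] makes [nth v c (size c)] the starting point again. *)
Section Cycle.
Variables (S : {set T}) (v : T) (p : seq T).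
Let c := v :: p.
Let f := nth v c.
Hypotheses (c_uniq : uniq c) (c_cycle : cycle e c) (c_size : 3 <= size c).
Hypotheses (c_sub : {subset c <= S})
  (p_deg : forall x, x \in p -> #|nbrs S x| <= 2).

Let X := [set x in c].
(** Every third position counted from [v]; [(size c + 2) %/ 3] is a third of the length, rounded
    up. *)
Let R := [set f (3 * k) | k : 'I_((size c + 2) %/ 3)].

Let f_edge i : i < size c -> e (f i) (f i.+1).
Proof.
move=> ic; have /(pathP v)/(_ i) := c_cycle.
rewrite size_rcons => /(_ ic).
by rewrite -rcons_cons !nth_rcons_default.
Qed.

Let f_in i : f i \in c.
Proof.
have [ic|ic] := ltnP i (size c); first exact: mem_nth.
by rewrite /f nth_default // mem_head.
Qed.

Let fE x : x \in c -> exists2 i, i < size c & x = f i.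
Proof. by move=> xc; exists (index x c); rewrite ?index_mem // /f nth_index. Qed.

Let f_inj i j : i < size c -> j < size c -> f i = f j -> i = j.
Proof. by move=> ic jc /eqP; rewrite nth_uniq // => /eqP. Qed.

Let f_size : f (size c) = v.
Proof. by rewrite /f nth_default. Qed.

Let f_prev_next i : 0 < i < size c -> f i.-1 != f i.+1.
Proof.
move=> /andP[i0 ic]; apply/eqP; have [ic'|] := ltnP i.+1 (size c).
  by move/f_inj => H; have := H _ _; lia.
move=> ic'; have -> : i.+1 = size c by lia.
(* The successor wraps around to [v = f 0]; equality would force a cycle of length 2. *)
rewrite f_size -[v]/(f 0) => /f_inj H; have := H _ _; lia.
Qed.

(** The two neighbours along the cycle exhaust the degree bound, so away from [v] there are neither
    chords nor edges leaving the cycle. *)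
Let nbrs_f i : 0 < i < size c -> nbrs S (f i) = [set f i.-1; f i.+1].
Proof.
move=> ib; have /andP[i0 ic] := ib; apply/esym/eqP.
rewrite eqEcard cards2 f_prev_next //; apply/andP; split.
  apply/subsetP => y; rewrite !inE => /orP[]/eqP->; rewrite c_sub ?f_in //=.
    by rewrite e_sym -{2}(prednK i0) f_edge //; lia.
  exact: f_edge.
apply: p_deg; case: i i0 ic {ib} => // i _ ic.
by rewrite /f /= mem_nth.
Qed.

Let card_X : #|X| = size c.
Proof. by rewrite cardsE; apply/card_uniqP. Qed.

Let R_mod i : i < size c -> 3 %| i -> f i \in R.
Proof.
move=> ic /dvdnP[k ik]; have kb : k < (size c + 2) %/ 3 by lia.
by apply/imsetP; exists (Ordinal kb) => //=; rewrite ik mulnC.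
Qed.

Let v_in_R : v \in R.
Proof. by rewrite -[v]/(f 0) R_mod //; lia. Qed.

Let in_XR x : x \in X :\: R -> exists i, [/\ i < size c, x = f i & ~~ (3 %| i)].
Proof.
case/setDP; rewrite inE => /fE[i ic ->] xR; exists i; split => //.
by apply: contra xR => /(R_mod ic).
Qed.

(** A chord at [v] would have its other end on [p], where [nbrs_f] excludes chords. *)
Let nbrs_v_cycle : [set y in X | e v y] = [set f 1; f (size c).-1].
Proof.
apply/setP => y; rewrite 2!inE in_set2; apply/andP/idP.
  case=> /fE[j jc ->] vfj; case: j jc vfj => [|j] jc vfj.
    by rewrite /f /= e_irr in vfj.
  have : v \in nbrs S (f j.+1) by rewrite in_nbrs e_sym vfj c_sub ?mem_head.
  rewrite nbrs_f // !inE /= => /orP[]/eqP E.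
    have -> : j = 0 by apply: f_inj; rewrite // -?E; lia.
    by rewrite eqxx.
  have -> : j.+1 = (size c).-1; last by rewrite eqxx orbT.
  have [j2|] := ltnP j.+2 (size c); last by lia.
  have : 0 = j.+2 by apply: f_inj; rewrite // -?E; lia.
  by [].
case/orP => /eqP ->; rewrite f_in; split=> //.
  by apply: (@f_edge 0).
by have := @f_edge (size c).-1 (ltnSn _); rewrite [_.-1.+1]/(size c) f_size e_sym.
Qed.

Let card_nbrs_v_cycle : #|[set y in X | e v y]| = 2.
Proof.
rewrite nbrs_v_cycle cards2; case: eqP => // /f_inj H.
by have := H _ _; lia.
Qed.

Let connect_v x : x \in c -> connect (induced_rel e X) v x.
Proof.
case/fE => i ic -> {x}; elim: i ic => [|i IH] ic; first exact: connect0.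
apply: connect_trans (IH (ltnW ic)) (connect_edge _ _ (f_edge (ltnW ic))).
  by rewrite inE f_in.
by rewrite inE f_in.
Qed.

(** Without [v] the cycle is a path with [size c - 2] edges; the edges at [v] are counted
    separately. *)
Let edges_rest : edges_in (S :\: X) + (size c - 2) <= edges_in (S :\ v).
Proof.
have := c_uniq; have := c_cycle; have := c_size; have := c_sub.
rewrite /X /c; case: p => [|x q] // sub _ cq uq.
have [vxq uxq] : v \notin x :: q /\ uniq (x :: q) by apply/andP.
have pq : path e x q.
  by move: cq; rewrite /= rcons_path => /and3P[].
have -> : S :\: [set z in [:: v, x & q]] = S :\ v :\: [set z in x :: q].
  by apply/setP => z; rewrite !inE !negb_or; case: (z == v); rewrite ?andbF.
have -> : size [:: v, x & q] - 2 = size q by rewrite /=; lia.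
apply: edges_in_path uxq pq _ => z zq; rewrite in_setD1 sub 1?in_cons ?zq ?orbT //.
by rewrite andbT; apply: contraNneq vxq => <-.
Qed.

Lemma induced_cycle_set : induced_cycle e X.
Proof.
apply/and3P; split; first by rewrite card_X.
  apply/forall_inP => x; rewrite inE => /fE[[|i] ic ->].
    by rewrite card_nbrs_v_cycle.
  have -> : [set y in X | e (f i.+1) y] = nbrs S (f i.+1).
    apply/setP => y; have := nbrs_f (i := i.+1) ic.
    move/setP/(_ y); rewrite !inE => E.
    case ey: (e _ y) in E *; rewrite ?andbF // !andbT in E *.
    apply/idP/idP => [yc|]; first by rewrite c_sub.
    by rewrite E => /orP[]/eqP ->; apply: f_in.
  by rewrite nbrs_f // cards2 f_prev_next.
apply/forall_inP => x; rewrite inE => xc; apply/forall_inP => y.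
rewrite inE => yc; apply: connect_trans (connect_v yc).
by rewrite connect_induced_sym connect_v.
Qed.

(** With [d] the degree of [v], at least [d + size c - 2] edges are lost and [#|Q|] is [d - 2], so
    [3 * #|R| <= size c + 1] suffices. This fails only for length 1 modulo 3, where the lost induced
    cycle supplies the missing unit. *)
Lemma reducible_cycle : exists X R Q, reducible S X R Q.
Proof.
have XS : X \subset S by apply/subsetP => x; rewrite inE => /c_sub.
have nbX i y : 0 < i < size c -> y \in nbrs S (f i) -> y \in X.
  by move=> /nbrs_f ->; rewrite !inE => /orP[]/eqP ->; apply: f_in.
exists X, R, (nbrs S v :\: X); split => //.
- exists v; first by rewrite inE mem_head.
  move=> y; rewrite inE => /connect_v; exact: connect_induced_sub.
- by apply/subsetP => _ /imsetP[k _ ->]; rewrite inE f_in.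
- by apply: setSD; apply/subsetP => z; rewrite in_nbrs => /andP[].
- move=> x y /in_XR[[|i] [ic -> _]] // /setDP[yS yX]; apply: contra yX => ey.
  by apply: (nbX i.+1); rewrite ?in_nbrs ?yS.
- apply/dissociationP => x /in_XR[i [ic -> i3]].
  have i0 : 0 < i by case: i i3 {ic}.
  have sub y : y \in nbrs (X :\: R) (f i) ->
      (y \notin R) && ((y == f i.-1) || (y == f i.+1)).
    rewrite in_nbrs => /andP[/setDP[yX yR] ey]; rewrite yR /= -in_set2.
    by rewrite -nbrs_f ?i0 // in_nbrs ey (subsetP XS).
  (* At position 1 modulo 3 the predecessor is charged; at position 2 the successor is, which may be
     [v] itself. *)
  have [i1|i1] := eqVneq (i %% 3) 1.
    rewrite -(cards1 (f i.+1)); apply/subset_leq_card/subsetP => y /sub.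
    case/andP=> yR /orP[/eqP yE|]; last by rewrite inE.
    by rewrite yE R_mod in yR; lia.
  rewrite -(cards1 (f i.-1)); apply/subset_leq_card/subsetP => y /sub.
  case/andP=> yR /orP[|/eqP yE]; first by rewrite inE.
  have [ic'|] := ltnP i.+1 (size c); first by rewrite yE R_mod in yR; lia.
  move=> ic'; have E : i.+1 = size c by lia.
  by rewrite yE E f_size v_in_R in yR.
- move=> x y; rewrite inE => /fE[[|i] ic ->] /setDP[yS yX] ey.
    by exists y => //; rewrite inE yX in_nbrs yS.
  by case/negP: yX; apply: (nbX i.+1); rewrite ?in_nbrs ?yS.
- have cR : #|R| <= (size c + 2) %/ 3.
    by rewrite (leq_trans (leq_imset_card _ _)) // card_ord.
  have cQ : #|nbrs S v :\: X| + 2 = #|nbrs S v|.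
    rewrite addnC -(cardsID X (nbrs S v)) -card_nbrs_v_cycle; congr (_ + _).
    apply: eq_card => y; rewrite in_setI in_nbrs inE [y \in X]inE.
    by case yc: (y \in c); rewrite ?andbF // (c_sub yc) andbT.
  have vS : v \in S by apply: c_sub; rewrite mem_head.
  have := edges_in_rem vS.
  have := cycles1_inS (subsetDl S X).
  have : #|X| %% 3 = 1 -> cycles1_in (S :\: X) < cycles1_in S.
    exact: cycles1_in_rem induced_cycle_set.
  have := edges_rest; rewrite card_X; lia.
Qed.

End Cycle.

(** * Walking through vertices of degree at most 2 *)

Lemma nbrs_three S x a b d : a \in nbrs S x -> b \in nbrs S x ->
  d \in nbrs S x -> uniq [:: a; b; d] -> 2 < #|nbrs S x|.
Proof.
move=> ax bx dx /card_uniqP /= <-; apply/subset_leq_card/subsetP => y.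
by rewrite !inE => /or3P[]/eqP ->; rewrite -?in_nbrs.
Qed.

(* The walk [v, z, ..., x', x] is kept reversed, as [x :: x' :: s], and
   extended at [x] until it stops at a leaf or returns to [v]. *)
Lemma reducible_walk S L v n x x' s :
    v \in S -> L \subset S ->
    (forall w, w \in L -> #|nbrs S w| <= 2) ->
    (forall w y, w \in L -> y \in nbrs S w -> y \in v |: L) ->
    #|T| - size s <= n ->
    uniq (x :: x' :: s) -> path e x (x' :: s) -> last x' s = v ->
    {subset belast x (x' :: s) <= L} ->
    (s = [::] -> #|nbrs S x| = 2) ->
  exists X R Q, reducible S X R Q.
Proof.
move=> vS LS L2 Lcl; elim: n x x' s => [|n IH] x x' s sn us ps lv sL s0.
  (* The walk has [size s + 2] distinct vertices, so [size s] stays below [#|T|] and the measure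
     cannot be 0. *)
  have := max_card [in x :: x' :: s]; rewrite (card_uniqP us) /= in sn *; lia.
have xL : x \in L by apply: sL; rewrite mem_head.
have xS := subsetP LS x xL.
have [xx' px's] : e x x' /\ path e x' s by apply/andP.
have sS : {subset x :: x' :: s <= S}.
  move=> y; rewrite lastI mem_rcons in_cons /= lv => /orP[/eqP-> //|].
  by move/sL/(subsetP LS).
have x'N : x' \in nbrs S x by rewrite in_nbrs xx' sS // !inE eqxx orbT.
(* If [x] is a leaf, the last two steps of the walk form a pendant path; [s0] excludes stopping at
   the first step. *)
have [yE|/set0Pn[y]] := eqVneq (nbrs S x :\ x') set0.
  have Nx : nbrs S x = [set x'].
    by rewrite -(setD1K x'N) yE setU0.
  case: s us ps lv sL px's sS sn s0 => [|w s] us ps lv sL px's sS sn s0.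
    by have := s0 erefl; rewrite Nx cards1.
  case/andP: px's => x'w pws.
  have x'L : x' \in L by apply: sL; rewrite /= !inE eqxx orbT.
  have xw : x != w.
    by move: us; rewrite /= !inE !negb_or => /andP[/and3P[]].
  apply: (@reducible_pendant S x x' w) => //.
  apply/esym/eqP; rewrite eqEcard cards2 xw L2 // andbT.
  apply/subsetP => y; rewrite !inE => /orP[]/eqP ->.
    by rewrite xS e_sym.
  by rewrite x'w sS // !inE eqxx !orbT.
rewrite in_setD1 => /andP[yx' yN].
have := yN; rewrite in_nbrs => /andP[yS xy].
have yx : y != x by apply: contraTneq xy => ->; rewrite e_irr.
have [ys|ys] := boolP (y \in s); last first.
  have yv : y != v.
    rewrite -lv; case: (s) ys => [//|a t] /=.
    by apply: contraNneq => ->; apply: mem_last.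
  have yL : y \in L.
    by have := Lcl x y xL yN; rewrite in_setU1 (negbTE yv).
  apply: (IH y x (x' :: s)) => //.
  - by rewrite /= subnS; case: (#|T| - size s) sn.
  - by rewrite cons_uniq us andbT !inE !negb_or yx yx' ys.
  - by rewrite [path _ _ _]/(e y x && path e x (x' :: s)) ps e_sym xy.
  - by move=> w; rewrite /= in_cons => /orP[/eqP ->|/sL].
have [yv|yv] := eqVneq y v.
  case/lastP: s us ps lv sL px's sS sn s0 ys => [//|t v'] us ps lv sL px's sS _ _ _.
  rewrite last_rcons in lv; subst y v'.
  apply: (@reducible_cycle S v [:: x, x' & t]) => //.
  - by move: us; rewrite -!rcons_cons rcons_uniq.
  - by rewrite /= e_sym xy.
  - by move=> w; rewrite inE => /orP[/eqP ->//|wt]; apply: sS;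
      rewrite -!rcons_cons mem_rcons inE wt orbT.
  - move=> w wt; apply: L2; apply: sL.
    by rewrite -rcons_cons belast_rcons.
(* Returning to an interior vertex [y] other than [v] would give it three neighbours: [x] and the
   two next to it on the walk. *)
case/splitPr: s / ys us ps lv sL px's sS {sn s0} => s1 [|w s2] us ps lv sL px's sS.
  by rewrite last_cat /= in lv; rewrite lv eqxx in yv.
have yL : y \in L.
  by have := Lcl x y xL yN; rewrite in_setU1 (negbTE yv).
move: (L2 y yL); rewrite leqNgt => /negP[].
move: px's; rewrite cat_path /= => /and4P[_ ly yw _].
have lin : last x' s1 \in x' :: s1 by apply: mem_last.
apply: (@nbrs_three _ _ x (last x' s1) w).
- by rewrite in_nbrs xS e_sym.
- rewrite in_nbrs e_sym ly andbT sS // in_cons -cat_cons mem_cat lin.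
  by rewrite orbT.
- by rewrite in_nbrs yw sS // !inE mem_cat !inE eqxx !orbT.
- move: us; rewrite cons_uniq -cat_cons; set l := last x' s1 in lin *.
  move=> /andP[xn]; rewrite cat_uniq => /and3P[_ /hasPn dj _].
  have wn : w \notin x' :: s1 by apply: dj; rewrite !inE eqxx orbT.
  rewrite /= !inE negb_or andbT -andbA; apply/and3P; split.
  + by apply: contraNneq xn => ->; rewrite mem_cat lin.
  + by apply: contraNneq xn => ->; rewrite mem_cat !inE eqxx !orbT.
  + by apply: contraNneq wn => <-.
Qed.

Lemma reducible_walk_start S L v z :
    v \in S -> L \subset S -> v \notin L ->
    (forall w, w \in L -> #|nbrs S w| <= 2) ->
    (forall w y, w \in L -> y \in nbrs S w -> y \in v |: L) ->
    z \in L -> e v z -> #|nbrs S z| = 2 ->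
  exists X R Q, reducible S X R Q.
Proof.
move=> vS LS vL L2 Lcl zL vz z2.
apply: (@reducible_walk S L v #|T| z v [::]) => //=.
- exact: leq_subr.
- by rewrite inE andbT; apply: contraNneq vL => <-.
- by rewrite e_sym vz.
- by move=> w; rewrite inE => /eqP ->.
Qed.

(** A neighbour [z] of [v] with degree 2 starts a walk with [L = S :\ v]. Otherwise [z] is a leaf,
    and [z v] is either a component or the start of a pendant path. *)
Lemma reducible_deg_le2 S v : v \in S ->
  (forall x, x \in S -> #|nbrs S x| <= 2) -> exists X R Q, reducible S X R Q.
Proof.
move=> vS S2.
have [Nv0|/set0Pn[z zN]] := eqVneq (nbrs S v) set0.
  by apply: (@reducible_small S v) => // [|y]; rewrite Nv0 ?cards0 ?inE.
have := zN; rewrite in_nbrs => /andP[zS vz].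
have vN : v \in nbrs S z by rewrite in_nbrs vS e_sym.
have zv : z != v by apply: contraTneq vz => ->; rewrite e_irr.
have [z2|z2] := eqVneq #|nbrs S z| 2.
  apply: (@reducible_walk_start S (S :\ v) v z) => //.
  - exact: subsetDl.
  - by rewrite !inE eqxx.
  - by move=> w /setD1P[_ /S2].
  - by move=> w y _; rewrite !inE => /andP[-> _]; case: eqP.
  - by rewrite !inE zv.
have z1 : #|nbrs S z| = 1.
  have := S2 z zS; have : 0 < #|nbrs S z| by apply/card_gt0P; exists v.
  lia.
have Nz : nbrs S z = [set v].
  by apply/esym/eqP; rewrite eqEcard sub1set vN z1 cards1.
have [w0|/set0Pn[w]] := eqVneq (nbrs S v :\ z) set0.
  apply: (@reducible_small S z) => //; first by rewrite z1.
  by move=> y; rewrite Nz => /set1P ->; rewrite -(setD1K zN) w0 setU0 cards1.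
case/setD1P => wz wN; apply: (@reducible_pendant S z v w) => //.
  apply/esym/eqP; rewrite eqEcard cards2 eq_sym wz S2 // andbT.
  by apply/subsetP => y /set2P[] ->.
by rewrite eq_sym.
Qed.

(** * Largest branches and the existence of a reduction *)

(** The walk is cut just before its first visit to [y]. *)
Lemma connect_before S x y : x != y -> x \in S ->
    connect (induced_rel e S) x y ->
  exists2 z, z \in nbrs S y & connect (induced_rel e (S :\ y)) x z.
Proof.
move=> xy xS cxy; have xSy : x \in S :\ y by rewrite !inE xy.
have : connect (induced_rel e (S :\ y)) x y \/
    exists2 z, z \in nbrs S y & connect (induced_rel e (S :\ y)) x z.
  pose A b := connect (induced_rel e (S :\ y)) x b \/
    exists2 z, z \in nbrs S y & connect (induced_rel e (S :\ y)) x z.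
  apply: (connect_ind_rcons (A := A) _ _ cxy); first by left; apply: connect0.
  move=> a b _ [xa|]; last by right.
  case/and3P=> aS bS ab; have [yb|yb] := eqVneq b y.
    by right; exists a => //; rewrite in_nbrs aS e_sym -yb.
  have aSy := connect_induced_mem xa xSy.
  left; apply: connect_trans xa (connect_edge aSy _ ab).
  by rewrite !inE yb.
by case=> // /connect_induced_mem/(_ xSy); rewrite !inE eqxx.
Qed.

(** The component of [q.2] after removing [q.1]; pairing the two lets a maximum be taken over all
    branches at once. *)
Definition branch S (q : T * T) :=
  [set z | connect (induced_rel e (S :\ q.1)) q.2 z].

(* If [K] is a largest branch at a vertex [v] of degree at least 3, then every
   vertex of another branch at [v] has degree at most 2: otherwise its branch
   through [v] would contain [v] together with [K]. *)
Lemma reducible_exists S : S != set0 -> exists X R Q, reducible S X R Q.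
Proof.
case/set0Pn => x0 x0S.
pose big q := [&& q.1 \in S, 2 < #|nbrs S q.1| & q.2 \in nbrs S q.1].
have [q0 q0big|nobig] := pickP big; last first.
  apply: (reducible_deg_le2 x0S) => x xS; rewrite leqNgt; apply/negP => x3.
  have [y yN] : exists y, y \in nbrs S x by apply/card_gt0P; lia.
  by have := nobig (x, y); rewrite /big /= xS x3 yN.
have [[v u] /and3P[/= vS v3 uN] maxK] := arg_maxnP (fun q => #|branch S q|) q0big.
have := uN; rewrite in_nbrs => /andP[uS vu].
pose K := branch S (v, u).
have [leaves|] := boolP [forall z in nbrs S v, (z \in K) || (#|nbrs S z| == 1)].
  apply: (reducible_leaves vS v3 uN) => z zN.
  have /forall_inP/(_ z zN)/orP[|/eqP] := leaves; last by right.
  by rewrite inE; left.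
rewrite negb_forall => /existsP[z]; rewrite negb_imply negb_or.
case/and3P=> zN zK z1; have := zN; rewrite in_nbrs => /andP[zS vz].
pose L := branch S (v, z).
have neq a b : e a b -> b != a by apply: contraTneq => ->; rewrite e_irr.
have zSv : z \in S :\ v by rewrite !inE zS neq.
have uSv : u \in S :\ v by rewrite !inE uS neq.
have LS w : w \in L -> w \in S :\ v.
  by rewrite inE => /connect_induced_mem/(_ zSv).
have LK w : w \in L -> w \notin K.
  rewrite !inE /= => zw; apply: contra zK => uw; rewrite inE.
  by apply: connect_trans uw _; rewrite connect_induced_sym.
have [/exists_inP[w wL w3]|] := boolP [exists w in L, 2 < #|nbrs S w|].
  have /setD1P[wv wS] := LS w wL.
  have vw : connect (induced_rel e S) v w.
    apply: connect_trans (connect_edge vS zS vz) _.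
    by move: wL; rewrite inE; apply: connect_induced_sub; apply: subsetDl.
  (* [y] is a neighbour of [w] in the direction of [v]; the pair [(w, y)] competes with [(v, u)],
     and its branch gains at least [v]. *)
  have [|y yN vy] := connect_before _ vS vw; first by rewrite eq_sym.
  have yv : connect (induced_rel e (S :\ w)) y v by rewrite connect_induced_sym.
  have bigw : big (w, y) by rewrite /big /= wS w3 yN.
  have := maxK _ bigw; rewrite leqNgt => /negP[].
  apply/proper_card/properP; split; last first.
    by exists v; rewrite !inE //= -/K; apply/negP => /connect_induced_mem/(_ uSv);
      rewrite !inE eqxx.
  apply/subsetP => a aK; rewrite inE /=; apply: connect_trans yv _.
  have wK := LK w wL.
  have uw : u \in S :\ w.
    by rewrite !inE uS andbT; apply: contraNneq wK => <-; rewrite inE connect0.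
  have vSw : v \in S :\ w by rewrite !inE vS eq_sym wv.
  apply: connect_trans (connect_edge vSw uw vu) _.
  move: aK; rewrite inE; apply: connect_induced_comp; apply/subsetP => b bK.
  rewrite in_setD1; apply/andP; split.
    by apply: contraNneq wK => <-.
  by move: bK; rewrite inE => /connect_induced_mem/(_ uSv)/setD1P[].
rewrite negb_exists => /forallP Lle.
have L2 w : w \in L -> #|nbrs S w| <= 2.
  by move=> wL; have := Lle w; rewrite wL /= -leqNgt.
have zL : z \in L by rewrite inE connect0.
apply: (@reducible_walk_start S L v z) => //.
- by apply/subsetP => w /LS/setD1P[].
- by apply/negP => /LS; rewrite !inE eqxx.
- move=> w y wL; rewrite in_nbrs => /andP[yS wy]; rewrite in_setU1.
  have [//|yv] := eqVneq y v; rewrite inE /=.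
  have := wL; rewrite inE /= => zw.
  by apply: connect_trans zw (connect_edge (LS w wL) _ wy); rewrite !inE yv.
(* [z] is adjacent to [v] and is not a leaf, so its degree is exactly 2. *)
- have := L2 z zL; have : 0 < #|nbrs S z|.
    by apply/card_gt0P; exists v; rewrite in_nbrs vS e_sym.
  lia.
Qed.

(** * Induction on the vertex set and the final bound *)

(** Each reduction changes the representatives by at most [#|Q| - 1], which cancels against
    [red_count]; what is left pays [3 * #|R|]. *)
Lemma small_P3_cover S P : P \subset S -> dominating S P ->
  exists R, [/\ R \subset S, dissociation_set e (S :\: R) &
    3 * #|R| <= edges_in S + #|P| + cycles1_in S].
Proof.
have [n] := ubnP #|S|; elim: n S P => // n IH S P Sn PS domP.
have [S0|/reducible_exists[X [R [Q red]]]] := eqVneq S set0.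
  exists set0; rewrite sub0set cards0; split=> //.
  by apply/dissociationP => x; rewrite S0 setD0 inE.
have [P' [P'S domP' cP']] := dominating_rem red PS domP.
have [XS [x0 x0X _] RX _ _ _ _ count] := red.
have lt : #|S :\: X| < #|S|.
  apply/proper_card/properP; split; first exact: subsetDl.
  by exists x0; rewrite ?inE ?x0X // (subsetP XS).
have [R' [R'S dR' cR']] := IH _ _ (leq_trans lt (leq_trans (leqnn _) Sn)) P'S domP'.
exists (R :|: R'); split.
- by rewrite subUset (subset_trans RX) // (subset_trans R'S) ?subsetDl.
- exact: reducible_step red R'S dR'.
- have := (leq_card_setU R R').1; lia.
Qed.

Lemma diss_bound :
  3 * #|T| <= 3 * diss e + (nedges e + ncomps e + c1 e).
Proof.
have relT : induced_rel e setT =2 e by move=> x y; rewrite /induced_rel /= !inE.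
have ET : edges_in setT = nedges e.
  apply: eq_card => E; rewrite !inE; apply: eq_existsb => x.
  by apply: eq_existsb => y; rewrite relT.
have CT : cycles1_in setT = c1 e.
  by apply: eq_card => C; rewrite !inE subsetT.
(* One root per component, so here [#|P|] is exactly the number of components. *)
pose P := [set x | roots e x].
have PT : #|P| = ncomps e.
  by apply: eq_card => x; rewrite !inE andbT.
have [|R [_ dR]] := @small_P3_cover setT P (subsetT _).
  move=> x _; exists (fingraph.root e x); last first.
    by rewrite (eq_connect relT) connect_root.
  by rewrite inE roots_root //; apply: sym_connect_sym.
rewrite ET CT PT => cR.
have : #|setT :\: R| <= diss e by apply: leq_bigmax_cond.
have := cardsC R; rewrite setTD; lia.
Qed.

End Reduction.

Theorem theorem1 (T : finType) (e : rel T)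
  (e_sym : symmetric e) (e_irr : irreflexive e) :
  (#|T|%:R - ((nedges e + ncomps e + c1 e)%:R) / 3 <= (diss e)%:R :> rat).
Proof.
rewrite lerBlDr -(@ler_pM2r _ 3) // mulrDl divfK //.
rewrite -[3]/(3%:R) -!natrM -natrD ler_nat.
by have := diss_bound e_sym e_irr; lia.
Qed.
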